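(* Let $\Gamma$ be an Abelian group of order $2^n$, $n>1$, such that $\Gamma\in\mathcal{G}$. Let $$m=\begin{cases}2\exp(\Gamma) & \text{if } \exp(\Gamma)=\frac{|\Gamma|}{2},\\ \max\{4,\exp(\Gamma)\} & \text{if } \exp(\Gamma)<\frac{|\Gamma|}{2}.\end{cases}$$ Then there exist a complete mapping $\varphi$ of $\Gamma$ and a partition $S_1,S_2,\ldots,S_t$ of the elements of $\Gamma$ such that $|S_i|=m$ and $\sum_{s\in S_i}s=\sum_{s\in S_i}\varphi(s)=0$ for every $1\leq i\leq t$.
   Context: Groups are finite Abelian, written additively. $\exp(\Gamma)$ is the least common multiple of the orders of all elements of $\Gamma$. An involution is an element of order $2$. $\mathcal{G}$ denotes the class of all finite Abelian groups that are of odd order or contain more than one involution. A complete mapping of $\Gamma$ is a bijection $\varphi\colon\Gamma\to\Gamma$ such that the mapping $g\mapsto g+\varphi(g)$ is also a bijection of $\Gamma$. *)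

(* Defs.v *)
From HB Require Import structures.
From mathcomp Require Import all_boot all_order all_algebra.
From mathcomp Require Import all_fingroup all_solvable.

Set Implicit Arguments.
Unset Strict Implicit.
Unset Printing Implicit Defensive.

Import GRing.Theory.
Local Open Scope ring_scope.

(* Finite Abelian groups are finZmodTypes.  Such a type is canonically a
   finGroupType for its addition, so the order of an element #[x]%g and
   exponent (the lcm of the orders) refer to the additive structure. *)

Definition involutions (Gamma : finZmodType) : {set Gamma} :=
  [set x : Gamma | #[x]%g == 2%N].

Definition in_calG (Gamma : finZmodType) : Prop :=
  odd #|Gamma| \/ (1 < #|involutions Gamma|)%N.

Definition group_exp (Gamma : finZmodType) : nat := exponent [set: Gamma].

Definition complete_mapping (Gamma : finZmodType) (phi : Gamma -> Gamma) : Prop :=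
  bijective phi /\ bijective (fun g : Gamma => g + phi g).

(* The theorem only uses this for groups of even order, so that the halving
   is exact.  For a 2-group in the class above, exp <= #|Gamma| / 2 (a cyclic
   2-group has at most one involution), so the else branch is exactly the
   case exp < #|Gamma| / 2. *)
Definition block_size (Gamma : finZmodType) : nat :=
  if group_exp Gamma == (#|Gamma| %/ 2)%N then (2 * group_exp Gamma)%N
  else maxn 4 (group_exp Gamma).

(* Main.v *)
Require Import Defs.
From HB Require Import structures.
From mathcomp Require Import all_boot all_order all_algebra.
From mathcomp Require Import all_fingroup all_solvable all_field.
From mathcomp Require classfun.
From mathcomp Require Import zify.

Set Implicit Arguments.
Unset Strict Implicit.
Unset Printing Implicit Defensive.

Import GRing.Theory.
Local Open Scope ring_scope.

(** A complete mapping phi is the same thing as a pair of permutations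
    alpha = phi and beta = id + phi whose difference is the identity, and
    M. Hall's theorem says that a function d on a finite Abelian group is a
    difference of two permutations as soon as the sum of its values is 0
    ([hall_differences]).  Hence a group whose elements add up to 0 has a
    complete mapping.  A direct sum of two groups of even order is such a
    group ([sum_morph_dprod]), because the sum of the elements of any subgroup
    is killed by 2.

    Complete mappings f of a subgroup H and q of Gamma / H combine to one of
    Gamma that sends a coset to a coset, f acting inside the cosets and q on
    them ([complete_mapping_extension]).  If exp(Gamma) divides |H| and the
    elements of H add up to 0, then so do the elements of each coset of H, as
    well as their images.  Thus the cosets of H are the blocks, and it
    remains to find H of order m such that H is a direct sum of two groups of
    even order, and Gamma / H is one as well or is trivial.

    Let x be an element of order exp(Gamma).  Then Gamma = <x> + K, a direct
    sum in which |K| is even, as Gamma has several involutions.  Let t be an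
    involution of K.
    - If |K| = 2, then m = |Gamma| and H = Gamma.
    - If |K| > 2 and exp(Gamma) > 2, then H = <2x> + <t>, whose quotient is
      the direct sum of <x> / <2x>, of order 2, and K / <t>.
    - If |K| > 2 and exp(Gamma) = 2, then m = 4 and H = <x> + <t>.  The
      quotient may have order 2, so it need not have a complete mapping.
      But Gamma is then the additive group of a field with at least 8
      elements, and multiplication by any c other than 0 and -1 is a complete
      mapping which, being additive, preserves zero sums. *)

(** * Differences of permutations *)

(** The two branches cannot collide: both permutations send [A] onto one and
    the same set, hence its complement onto the complement of that set. *)
Lemma mix_perm_inj (T : finType) (alpha gamma : {perm T}) (A : {set T}) :
  alpha @: A = gamma @: A ->
  injective (fun i => if i \in A then gamma i else alpha i).
Proof.
have mixed i j (a b : {perm T}) :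
    i \in A -> j \notin A -> a @: A = b @: A -> b i = a j -> False.
  move=> iA jA ab bi_aj; have: a j \in a @: A by rewrite ab -bi_aj imset_f.
  by rewrite (mem_imset _ _ (@perm_inj _ a)) (negPf jA).
move=> eqA i j /=; case: ifPn => iA; case: ifPn => jA; try exact: perm_inj.
  by move/(mixed _ _ _ _ iA jA eqA).
by move/esym/(mixed _ _ _ _ jA iA eqA).
Qed.

(** Multiplying a permutation by the transposition of [u] and [v] splits their
    common cycle if they share one, and joins their cycles otherwise; the proof
    compares the numbers of cycles. *)
Lemma porbit_tperm_separates (T : finType) (s : {perm T}) (u v : T) :
  u != v -> (u \notin porbit s v) || (u \notin porbit (tperm u v * s)%g v).
Proof.
move=> uv; have := porbits_mul_tperm s u v.
have /= := porbits_mul_tperm (tperm u v * s)%g u v.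
rewrite mulgA tperm2 mul1g uv => e1 e2.
case: (u \notin _) e2 => //; case: (u \notin _) e1 => //= e1 e2.
by exfalso; lia.
Qed.

(** Read each index i as an arrow from alpha i to gamma i: the arrows form
    disjoint cycles, and reversing an arrow keeps its sum alpha i + gamma i.
    As the sums at [u] and [v] are allowed to change, the arrows [u] and [v]
    may exchange their targets, so one may assume that they lie on different
    cycles.  Reverse the whole cycle of [v], then let [u] and [v] exchange
    their targets: [u] now ends at the former source of [v]. *)
Lemma swap_along_cycles (M : finZmodType) (alpha gamma : {perm M}) (u v : M) :
  u != v ->
  exists alpha' gamma' : {perm M},
    alpha' u + gamma' u = alpha u + alpha v
    /\ forall i, i != u -> i != v ->
         alpha' i + gamma' i = alpha i + gamma i.
Proof.
move=> uv.
wlog sep : gamma / u \notin porbit (gamma * alpha^-1)%g v.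
  move=> swap; case/orP: (porbit_tperm_separates (gamma * alpha^-1)%g uv).
    exact: swap.
  rewrite mulgA => /swap[a' [g' [eq_u eq_i]]].
  exists a', g'; split=> // i iu iv.
  by rewrite eq_i // permM tpermD // eq_sym.
set A := porbit _ v in sep.
have vA : v \in A by apply: porbit_id.
have eqA : alpha @: A = gamma @: A.
  apply/esym/eqP; rewrite eqEcard !card_imset ?leqnn ?andbT;
    try exact: perm_inj.
  apply/subsetP=> _ /imsetP[_ /porbitP[k ->] ->]; set x := (X in gamma X).
  apply/imsetP; exists ((gamma * alpha^-1)%g x); last by rewrite permM permKV.
  by rewrite -permM -expgSr mem_porbit.
pose a' := perm (mix_perm_inj eqA).
pose g' := (tperm u v * perm (mix_perm_inj (esym eqA)))%g.
exists a', g'; split=> [|i iu iv]; rewrite permM ?tpermL !permE.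
  by rewrite (negPf sep) vA.
rewrite /= !(eq_sym i) in iu iv *.
by rewrite (negPf iu) (negPf iv); case: ifP => //; rewrite addrC.
Qed.

(** Hall's exchange: the difference at [u] can be prescribed if the one at [v]
    is left free.  The constant [k] is chosen so that, writing
    beta = k - gamma, differences become sums alpha + gamma and the value
    alpha u + alpha v of the preceding lemma becomes the difference [e]. *)
Lemma difference_exchange (M : finZmodType) (alpha beta : {perm M})
    (u v e : M) :
  u != v ->
  exists alpha' beta' : {perm M},
    beta' u - alpha' u = e
    /\ forall i, i != u -> i != v -> beta' i - alpha' i = beta i - alpha i.
Proof.
move=> uv; pose k := alpha u + alpha v + e.
have reflectK : involutive (fun x => k - x) by move=> x; rewrite subKr.
pose r := perm (can_inj reflectK).
have [a' [g' [eq_u eq_i]]] := swap_along_cycles alpha (beta * r)%g uv.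
exists a', (g' * r)%g; split=> [|i iu iv]; rewrite permM permE.
  by rewrite -addrA -opprD (addrC (g' u)) eq_u addrC addKr.
rewrite -addrA -opprD (addrC (g' i)) eq_i // permM permE.
by rewrite opprD opprB addrCA [k + _]addrC subrK addrC.
Qed.

(** Each exchange corrects one wrong difference for good.  A single wrong one
    cannot be left, because the differences of two permutations add up to 0. *)
Theorem hall_differences (M : finZmodType) (d : M -> M) :
  \sum_x d x = 0 ->
  exists alpha beta : {perm M}, forall x, beta x - alpha x = d x.
Proof.
move=> sum_d.
have sum_perm (s : {perm M}) : \sum_x s x = \sum_x x.
  by rewrite [RHS](reindex_inj (@perm_inj _ s)).
pose bad (a b : {perm M}) := [set x | b x - a x != d x].
suff reduce k : forall a b, (#|bad a b| <= k)%N ->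
    exists a' b', bad a' b' = set0.
  have [a [b bad0]] := reduce _ 1%g 1%g (leqnn _).
  exists a, b => x; apply/eqP/negbNE/negP=> bad_x.
  by have := in_set0 x; rewrite -bad0 inE bad_x.
elim: k => [|k IHk] a b; first by rewrite leqn0 cards_eq0 => /eqP; exists a, b.
move=> le_k; case: (set_0Vmem (bad a b)) => [bad0 | [u bad_u]].
  by exists a, b.
case: (set_0Vmem (bad a b :\ u)) => [bad1 | [v]]; last first.
  case/setD1P=> vu bad_v.
  have uv : u != v by rewrite eq_sym.
  have [a' [b' [good_u eq_i]]] := difference_exchange a b (d u) uv.
  apply: (IHk a' b'); rewrite -ltnS (leq_trans _ le_k) //.
  apply/proper_card/properP; split; last first.
    by exists u => //; rewrite inE good_u eqxx.
  apply/subsetP=> i; have [-> // | iv] := eqVneq i v.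
  have [-> // | iu] := eqVneq i u.
  by rewrite !inE eq_i.
have good i : i != u -> b i - a i = d i.
  move=> iu; apply/eqP/negbNE/negP=> bad_i.
  by have := in_set0 i; rewrite -bad1 !inE iu bad_i.
have : \sum_x (b x - a x) = \sum_x d x by rewrite sumrB !sum_perm subrr sum_d.
rewrite (bigD1 u) // [in RHS](bigD1 u) //= (eq_bigr d) => [/addIr good_u|i iu].
  by move: bad_u; rewrite inE good_u eqxx.
exact: good.
Qed.

Corollary complete_mapping_of_sum0 (M : finZmodType) :
  \sum_(x : M) x = 0 ->
  exists phi : M -> M, injective phi /\ injective (fun x => x + phi x).
Proof.
move/hall_differences=> [a [b dif]]; exists a; split; first exact: perm_inj.
have sum_b x : x + a x = b x by rewrite -[X in X + _]dif subrK.
by move=> x y; rewrite !sum_b; apply: perm_inj.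
Qed.

(** * Direct products of groups of even order *)

Local Open Scope group_scope.

(** The same elements under the group law written additively: the results on
    differences of permutations thereby apply to subgroups and quotients. *)
Definition additive_copy (gT : finGroupType)
  (mulC : commutative (@mulg gT)) : Type := gT.
HB.instance Definition _ (gT : finGroupType) (mulC : commutative (@mulg gT)) :=
  Finite.on (additive_copy mulC).
HB.instance Definition _ (gT : finGroupType) (mulC : commutative (@mulg gT)) :=
  GRing.isZmodule.Build (additive_copy mulC)
    (@mulgA gT) mulC (@mul1g gT) (@mulVg gT).

Lemma subg_mulC (gT : finGroupType) (G : {group gT}) :
  abelian G -> commutative (@mulg (subg_of G)).
Proof.
move=> abG x y; apply: val_inj.
by rewrite /= (centsP abG) ?subgP.
Qed.

(** Inversion permutes [A] and changes the sign of the sum. *)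
Lemma sum_morph_double (gT : finGroupType) (V : zmodType) (A : {group gT})
    (F : gT -> V) :
  {in A &, {morph F : x y / x * y >-> (x + y)%R}} ->
  ((\sum_(x in A) F x) *+ 2 = 0)%R.
Proof.
move=> FM; have F1 : F 1 = 0%R.
  by apply: (addrI (F 1)); rewrite -FM ?group1 // mulg1 addr0.
rewrite mulr2n {2}(reindex_inj invg_inj) /=.
rewrite [X in (_ + X)%R](eq_bigl (mem A)) => [|x]; last by rewrite groupV.
rewrite -big_split big1 // => x xA /=.
by rewrite -FM ?groupV // mulgV.
Qed.

(** The sum is |B| times the sum over [A] plus |A| times the sum over [B], and
    both of these are killed by 2. *)
Lemma sum_morph_dprod (gT : finGroupType) (V : zmodType) (A B G : {group gT})
    (F : gT -> V) :
  A \x B = G -> (2 %| #|A|)%N -> (2 %| #|B|)%N ->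
  {in G &, {morph F : x y / x * y >-> (x + y)%R}} ->
  (\sum_(x in G) F x = 0)%R.
Proof.
move=> defG evenA evenB FM; have /mulG_sub[sAG sBG] := dprodW defG.
rewrite (classfun.reindex_dprod defG).
transitivity (\sum_(a in A) (F a *+ #|B| + \sum_(b in B) F b))%R.
  apply: eq_bigr => a aA; rewrite -sumr_const -big_split.
  apply: eq_bigr => b bB.
  by rewrite FM ?(subsetP sAG a) ?(subsetP sBG b).
have sum0 (C : {group gT}) k : C \subset G -> (2 %| k)%N ->
    ((\sum_(x in C) F x) *+ k = 0)%R.
  move=> sCG /dvdnP[j ->]; rewrite mulnC mulrnA sum_morph_double ?mul0rn //.
  by move=> x y xC yC; apply: FM; apply: (subsetP sCG).
by rewrite big_split /= sumr_const sumrMnl !sum0 ?addr0.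
Qed.

(** Complete mappings relative to a subset, so that subgroups and quotients need
    not be turned into types. *)
Definition complete_on (gT : finGroupType) (G : {set gT}) (f : gT -> gT) :=
  [/\ {in G, forall x, f x \in G}, {in G &, injective f}
    & {in G &, injective (fun x => x * f x)}].

Lemma complete_on_dprod (gT : finGroupType) (A B G : {group gT}) :
  abelian G -> A \x B = G -> (2 %| #|A|)%N -> (2 %| #|B|)%N ->
  exists f, complete_on G f.
Proof.
move=> abG defG evenA evenB.
pose M := additive_copy (@subg_mulC gT G abG).
have sum0 : (\sum_(x : M) x = 0)%R.
  transitivity (\sum_(x in G) (subg G x : M))%R; last first.
    by apply: sum_morph_dprod defG evenA evenB _ => x y xG yG; apply: subgM.
  rewrite [RHS](reindex (fun u : M => sgval (u : subg_of G))) /=.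
    by apply: eq_big => u; rewrite ?sgvalK // subgP.
  by exists (subg G) => x xG; rewrite ?sgvalK ?subgK.
have [phi [phi_inj add_inj]] := complete_mapping_of_sum0 sum0.
exists (fun x => sgval (phi (subg G x) : subg_of G)).
split=> [x _|x y xG yG|x y xG yG].
- exact: subgP.
- by move/val_inj/phi_inj/(congr1 sgval); rewrite !subgK.
have mulE z : z \in G ->
    z * sgval (phi (subg G z) : subg_of G)
    = sgval ((subg G z : M) + phi (subg G z) : M)%R.
  by move=> zG; rewrite -{1}(subgK z zG).
by rewrite !mulE // => /val_inj/add_inj/(congr1 sgval); rewrite !subgK.
Qed.

(** * Complete mappings respecting the cosets of a subgroup *)

Lemma sum_rcoset (Gamma : finZmodType) (V : zmodType) (H : {group Gamma})
    (F : Gamma -> V) (c : Gamma) :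
  (\sum_(x in H :* c) F x = \sum_(h in H) F (h * c)%g)%R.
Proof.
rewrite (reindex_inj (mulIg c)); apply: eq_bigl => h.
by rewrite mem_rcoset mulgK.
Qed.

Lemma mulrn_exponent0 (Gamma : finZmodType) (x : Gamma) k :
  (exponent [set: Gamma] %| k)%N -> (x *+ k = 0)%R.
Proof.
move=> dvd_k; have : x ^+ k = 1 by apply: (exponentP dvd_k); rewrite inE.
by [].
Qed.

(** Write x = h + r with h in [H] and r the chosen representative of its coset
    C, and send x to f h + r' with r' the representative of q C.  On the coset C
    the sum of the images is |H| r' plus the sum of the values of [f], which
    are the elements of [H]. *)
Lemma complete_mapping_extension (Gamma : finZmodType) (H : {group Gamma})
    (f : Gamma -> Gamma) (q : coset_of H -> coset_of H) :
  (exponent [set: Gamma] %| #|H|)%N -> (\sum_(h in H) h = 0)%R ->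
  complete_on H f -> complete_on ([set: Gamma] / H) q ->
  exists phi, complete_mapping phi
    /\ forall c, (\sum_(x in H :* c) phi x = 0)%R.
Proof.
move=> exp_dvd sumH [f_in f_inj f_add] [_ q_inj q_add].
have nH x : x \in 'N(H).
  by have /subsetP-> := sub_abelian_norm (FinRing.zmod_abelian _) (subsetT H).
pose r (x : Gamma) := repr (coset H x).
have rK x : coset H (r x) = coset H x by apply: coset_reprK.
have inQ x : coset H x \in [set: Gamma] / H.
  by apply: mem_quotient; rewrite inE.
have diffH x : x * (r x)^-1 \in H.
  by apply: coset_idr; rewrite ?nH // morphM ?morphV ?groupV ?nH //= rK mulgV.
pose phi x : Gamma := f (x * (r x)^-1) * repr (q (coset H x)).
have coset_phi x : coset H (phi x) = q (coset H x).
  by rewrite /phi morphM ?nH //= coset_id ?f_in // mul1g coset_reprK.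
have same_coset x y : coset H x = coset H y -> r x = r y by rewrite /r => ->.
exists phi; split; first split.
- apply: injF_bij => x y eq_phi.
  have eq_c : coset H x = coset H y.
    by apply: q_inj; rewrite // -!coset_phi eq_phi.
  move: eq_phi; rewrite /phi eq_c => /mulIg/f_inj.
  by rewrite !diffH (same_coset _ _ eq_c) => /(_ isT isT)/mulIg.
- apply: injF_bij => x y /= eq_add.
  have eq_c : coset H x = coset H y.
    apply: q_add => //; rewrite -!coset_phi -!morphM ?nH //=.
    by congr coset; exact: eq_add.
  have eq_r := same_coset _ _ eq_c.
  have split_add z :
      (z + phi z)%R = ((z * (r z)^-1) * f (z * (r z)^-1))
                      * (r z * repr (q (coset H z))).
    rewrite /phi [LHS]/(z * (_ * _)); set a := f _; set b := repr (q _).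
    rewrite -!mulgA; congr (z * _).
    by rewrite [RHS]mulgA [(r z)^-1 * a]addrC -mulgA mulKg.
  move: eq_add; rewrite !split_add eq_c eq_r => /mulIg/f_add.
  by rewrite -{1}eq_r !diffH => /(_ isT isT)/mulIg.
move=> c; rewrite sum_rcoset.
pose d := c * (r c)^-1.
have phi_c h : h \in H -> phi (h * c) = (f (h * d)%g + repr (q (coset H c)))%R.
  move=> hH; have eq_c : coset H (h * c) = coset H c.
    by rewrite morphM ?nH //= coset_id ?mul1g.
  by rewrite /phi (same_coset _ _ eq_c) eq_c -mulgA.
rewrite (eq_bigr _ phi_c) big_split /= sumr_const mulrn_exponent0 // addr0.
rewrite -(sum_rcoset H f d) rcoset_id ?diffH // -(big_imset id) //=.
rewrite (_ : f @: H = H) //; apply/eqP.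
rewrite eqEcard card_in_imset // leqnn andbT.
by apply/subsetP=> _ /imsetP[h hH ->]; apply: f_in.
Qed.

Lemma partition_into_rcosets (Gamma : finZmodType) (H : {group Gamma})
    (phi : Gamma -> Gamma) :
  complete_mapping phi -> (forall c, \sum_(x in H :* c) phi x = 0)%R ->
  (exponent [set: Gamma] %| #|H|)%N -> (\sum_(h in H) h = 0)%R ->
  exists (psi : Gamma -> Gamma) (P : {set {set Gamma}}),
    [/\ complete_mapping psi,
        partition P [set: Gamma]
      & forall S : {set Gamma}, S \in P ->
          [/\ #|S| = #|H|,
              \sum_(s in S) s = 0
            & \sum_(s in S) psi s = 0]]%R.
Proof.
move=> phiP phi0 exp_dvd sumH; exists phi, (rcosets H [set: Gamma]).
split=> // [|S /rcosetsP[c _ ->]]; first exact: rcosets_partition (subsetT H).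
rewrite card_rcoset phi0 sum_rcoset; split=> //.
by rewrite big_split /= sumH sumr_const add0r mulrn_exponent0.
Qed.

(** * Elementary Abelian groups, quotients and involutions *)

(** [Gamma] is the additive group of a field, where multiplication by a scalar
    [c] is complete if and only if [c] and 1 + c are nonzero. *)
Lemma additive_complete_mapping (Gamma : finZmodType) (n : nat) :
  (1 < n)%N -> #|Gamma| = (2 ^ n)%N -> 2.-abelem [set: Gamma] ->
  exists phi : Gamma -> Gamma,
    complete_mapping phi /\ {morph phi : x y / (x + y)%R}.
Proof.
move=> n_gt1 cardG abelG.
have [F charF cardF] := @pPrimePowerField 2 n isT (ltnW n_gt1).
have : [set: Gamma] \isog [set: F].
  rewrite (isog_abelem_card _ abelG) fin_ring_pchar_abelem //=.
  by rewrite !cardsT cardF cardG.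
case/isogP=> f /injmP f_injm _.
have f_inj : injective f by move=> x y; apply: f_injm; rewrite inE.
have fD : {morph f : x y / (x + y)%R}.
  by move=> x y; apply: (morphM f); rewrite inE.
have [g fK gK] : bijective f by apply: inj_card_bij; rewrite // cardF cardG.
have [c c0 c1] : exists2 c : F, (c != 0)%R & (1 + c != 0)%R.
  have : (0 < #|~: [set 0%R; (- 1)%R : F]|)%N.
    rewrite cardsCs setCK cardF subn_gt0 cards2 (@leq_ltn_trans 2) //.
      by case: (_ != _).
    by rewrite -[X in (X < _)%N](expn1 2) ltn_exp2l.
  case/card_gt0P=> c; rewrite !inE negb_or => /andP[c0 c1]; exists c => //.
  by rewrite addrC addr_eq0.
exists (fun x => g (c * f x)%R); split; first split.
- by apply: injF_bij => x y /(can_inj gK)/(mulfI c0)/f_inj.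
- apply: injF_bij => x y /(congr1 f); rewrite !fD !gK.
  rewrite -[X in (X + _ = _)%R]mul1r -[X in (_ = X + _)%R]mul1r -!mulrDl.
  by move=> /(mulfI c1)/f_inj.
by move=> x y; apply: f_inj; rewrite !(fD, gK) mulrDr.
Qed.

(** The factors meet [H] in [Y] and [T], by the modular law, so their images
    have orders |X| / |Y| and |K| / |T|, whose product is the order of
    [G / H].  Hence the images, which generate [G / H], meet trivially. *)
Lemma quotient_dprod (gT : finGroupType) (X K Y T G H : {group gT}) :
  abelian G -> X \x K = G -> Y \x T = H -> Y \subset X -> T \subset K ->
  [/\ (X / H) \x (K / H) = G / H, (#|X / H| * #|Y| = #|X|)%N
    & (#|K / H| * #|T| = #|K|)%N].
Proof.
move=> abG defG defH sYX sTK.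
have [/mulG_sub[sXG sKG] [_ _ _ tiXK]] := (dprodW defG, dprodP defG).
have sHG : H \subset G.
  by rewrite -(dprodW defH) mul_subG ?(subset_trans sYX) ?(subset_trans sTK).
have nH (A : {group gT}) : A \subset G -> A \subset 'N(H).
  by move=> sAG; rewrite (subset_trans sAG) ?sub_abelian_norm.
have HX : X :&: H = Y.
  rewrite setIC -(dprodW defH) -group_modl //.
  rewrite (_ : T :&: X = 1) ?mulg1 //.
  by have := setIS X sTK; rewrite tiXK setIC => /trivgP.
have HK : K :&: H = T.
  rewrite -(dprodW defH) -group_modr //.
  rewrite (_ : K :&: Y = 1) ?mul1g //.
  by have := setSI K sYX; rewrite tiXK setIC => /trivgP.
have cardX : (#|X / H| * #|Y| = #|X|)%N.
  by rewrite card_quotient ?nH // -indexgI HX mulnC Lagrange.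
have cardK : (#|K / H| * #|T| = #|K|)%N.
  by rewrite card_quotient ?nH // -indexgI HK mulnC Lagrange.
split=> //.
have prod : (X / H) * (K / H) = G / H.
  by rewrite -quotientMl ?nH // (dprodW defG).
have abGH : abelian (G / H) by apply: quotient_abelian.
have [sXGH sKGH] := mulG_sub prod.
rewrite dprodE //; first by rewrite (centsS sXGH) // (subset_trans sKGH).
have := mul_cardG (X / H) (K / H).
have cardGH : (#|G / H| * #|H| = #|G|)%N.
  by rewrite card_quotient ?nH // mulnC Lagrange.
rewrite prod => /eqP; rewrite eq_sym -(eqn_pmul2r (cardG_gt0 H)).
rewrite mulnAC cardGH -(dprod_card defG) -(dprod_card defH).
rewrite -cardX -cardK mulnACA.
rewrite -[X in _ == X]muln1 eqn_pmul2l ?muln_gt0 ?cardG_gt0 //.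
by rewrite -trivg_card1 => /eqP.
Qed.

Lemma cyclic_involutions (Gamma : finZmodType) :
  cyclic [set: Gamma] -> (#|involutions Gamma| <= 1)%N.
Proof.
move=> cycG; apply/card_le1_eqP => u v; rewrite !inE => /eqP ou /eqP ov.
have : u \in <[v]>.
  rewrite -(eqP (_ : <[u]> == <[v]>)) ?cycle_id //.
  by rewrite (eq_subG_cyclic cycG) ?subsetT // -!orderE ou ov.
rewrite cycle2g // !inE => /orP[]/eqP // u1.
by move: ou; rewrite u1 order1.
Qed.

(** * The theorem *)

Local Open Scope ring_scope.

Theorem theorem3p3 (Gamma : finZmodType) (n : nat)
    (n_gt1 : (1 < n)%N)
    (card_Gamma : #|Gamma| = (2 ^ n)%N)
    (Gamma_calG : in_calG Gamma) :
  exists (phi : Gamma -> Gamma) (P : {set {set Gamma}}),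
    [/\ complete_mapping phi,
        partition P [set: Gamma]
      & forall S : {set Gamma}, S \in P ->
          [/\ #|S| = block_size Gamma,
              \sum_(s in S) s = 0
            & \sum_(s in S) phi s = 0]].
Proof.
have abG : abelian [set: Gamma] by apply: FinRing.zmod_abelian.
have ncyc : ~~ cyclic [set: Gamma].
  apply/negP=> /cyclic_involutions le1; case: Gamma_calG => [|lt1].
    by rewrite card_Gamma oddX -(subnKC n_gt1).
  by have := leq_trans lt1 le1; rewrite ltnn.
have [x _ exp_x] := exponent_witness (abelian_nil abG).
have [K /complP[tiK prodK]] :=
  splitsP (abelian_splits (in_setT x) (esym exp_x) abG).
have defG : <[x]>%G \x K = [set: Gamma].
  by rewrite dprodE // (sub_abelian_cent2 abG) ?subsetT.
have cardG : (#[x]%g * #|K| = 2 ^ n)%N.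
  by rewrite -card_Gamma -cardsT -(dprod_card defG).
have [a _ ox] : exists2 a, (a <= n)%N & #[x]%g = (2 ^ a)%N.
  by apply/dvdn_pfactor; rewrite // -cardG dvdn_mulr.
have [k _ oK] : exists2 k, (k <= n)%N & #|K| = (2 ^ k)%N.
  by apply/dvdn_pfactor; rewrite // -cardG dvdn_mull.
have nE : n = (a + k)%N.
  by move: cardG; rewrite ox oK -expnD => /eqP; rewrite eqn_exp2l // => /eqP.
have k_gt0 : (0 < k)%N.
  rewrite lt0n; apply: contraNneq ncyc => k0.
  have K1 : K :=: 1%g by apply: card1_trivg; rewrite oK k0.
  by rewrite -prodK K1 mulg1 cycle_cyclic.
have evenK : (2 %| #|K|)%N by rewrite oK -(prednK k_gt0) expnS dvdn_mulr.
have [t tK ot] := @Cauchy _ 2 K isT evenK.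
have a_gt0 : (0 < a)%N.
  have := dvdn_exponent (in_setT t); rewrite exp_x ot ox.
  by case: (a).
have evenX : (2 %| #|<[x]>%G|)%N.
  by rewrite -orderE ox -(prednK a_gt0) expnS dvdn_mulr.
have sum_id (A B C : {group Gamma}) : (A \x B)%g = C ->
    (2 %| #|A|)%N -> (2 %| #|B|)%N -> \sum_(c in C) c = 0.
  by move=> defC evA evB; apply: sum_morph_dprod defC evA evB _.
have sTK : <[t]>%g \subset K by rewrite cycle_subG.
have dprod_t (Y : {group Gamma}) : Y \subset <[x]>%g ->
    exists H : {group Gamma}, (Y \x <[t]>)%g = H.
  move=> sYX; exists (Y <*> <[t]>)%G; rewrite dprodEY //.
    by rewrite (sub_abelian_cent2 abG) ?subsetT.
  by apply/trivgP; rewrite -tiK setISS.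
have evenT : (2 %| #|<[t]>%G|)%N by rewrite -orderE ot.
have blockE : block_size Gamma =
    if k == 1%N then (2 * 2 ^ a)%N else maxn 4 (2 ^ a).
  rewrite /block_size /group_exp exp_x ox card_Gamma nE -(prednK k_gt0) addnS.
  by rewrite expnS mulKn // eqn_exp2l // -[X in X == _]addn0 eqn_add2l eq_sym.
have [k1 | k_neq1] := eqVneq k 1%N.
  have [f f_compl] := complete_on_dprod abG defG evenX evenK.
  (* The quotient by Gamma is trivial, and the identity is complete on it. *)
  have := @complete_mapping_extension Gamma [set: Gamma]%G f id.
  have exp_dvd : (exponent [set: Gamma] %| #|[set: Gamma]%G|)%N.
    by apply: exponent_dvdn.
  have sumG := sum_id _ _ [set: Gamma]%G defG evenX evenK.
  case=> // [|phi [phi_compl phi0]].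
    rewrite trivg_quotient.
    by split=> [//|u v|u v]; rewrite !inE => /eqP-> /eqP->.
  have := partition_into_rcosets phi_compl phi0 exp_dvd sumG.
  by rewrite blockE k1 eqxx cardsT card_Gamma nE k1 addn1 expnS.
have k_gt1 : (1 < k)%N by lia.
have [a1 | a_neq1] := eqVneq a 1%N.
  have [H defH] := dprod_t <[x]>%G (subxx _).
  have cardH : #|H| = 4%N.
    by rewrite -(dprod_card defH) -!orderE ox ot a1.
  have abelG : 2.-abelem [set: Gamma].
    by rewrite abelemE // abG exp_x ox a1.
  have [phi [phi_compl phiD]] :=
    additive_complete_mapping n_gt1 card_Gamma abelG.
  have phi0 : phi 0 = 0 by apply: (addrI (phi 0)); rewrite -phiD !addr0.
  have exp_dvd : (exponent [set: Gamma] %| #|H|)%N by rewrite exp_x ox a1 cardH.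
  have sumH := sum_id _ _ _ defH evenX evenT.
  have := partition_into_rcosets phi_compl _ exp_dvd sumH.
  rewrite blockE (negPf k_neq1) a1 cardH; apply=> c.
  rewrite -(big_morph phi phiD phi0) sum_rcoset big_split /= sumH.
  by rewrite sumr_const add0r mulrn_exponent0.
have a_gt1 : (1 < a)%N by lia.
have sYX : <[x ^+ 2]>%g \subset <[x]>%g by apply: cycleX.
have [H defH] := dprod_t <[x ^+ 2]>%G sYX.
have oY : #|<[x ^+ 2]>%G| = (2 ^ a.-1)%N.
  by rewrite -orderE orderXdiv ox -(prednK a_gt0) expnS ?mulKn // dvdn_mulr.
have cardH : #|H| = (2 ^ a)%N.
  by rewrite -(dprod_card defH) oY -orderE ot mulnC -expnS prednK.
have evenY : (2 %| #|<[x ^+ 2]>%G|)%N.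
  by rewrite oY -(subnKC a_gt1) /= expnS dvdn_mulr.
have exp_dvd : (exponent [set: Gamma] %| #|H|)%N by rewrite exp_x ox cardH.
have sumH := sum_id _ _ _ defH evenY evenT.
have [f f_compl] := complete_on_dprod (FinRing.zmod_abelian H) defH evenY evenT.
have [defQ cardXH cardKH] :=
  @quotient_dprod Gamma <[x]>%G K <[x ^+ 2]>%G <[t]>%G [set: Gamma]%G H
    abG defG defH sYX sTK.
have [q q_compl] : exists q, complete_on ([set: Gamma] / H)%g q.
  apply: complete_on_dprod defQ _ _; first exact: quotient_abelian.
    have : (2 ^ a.-1 * 2 %| #|(<[x]> / H)%g| * 2 ^ a.-1)%N.
      by rewrite -{2}oY cardXH mulnC -expnS prednK // -ox.
    by rewrite mulnC dvdn_pmul2r ?expn_gt0.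
  have : (2 * 2 %| #|(K / H)%g| * 2)%N.
    by rewrite -{3}ot orderE cardKH oK -(subnKC k_gt1) !expnS mulnA dvdn_mulr.
  by rewrite dvdn_pmul2r.
have [phi [phi_compl phi0]] :=
  complete_mapping_extension exp_dvd sumH f_compl q_compl.
have := partition_into_rcosets phi_compl phi0 exp_dvd sumH.
rewrite cardH blockE (negPf k_neq1) (maxn_idPr _) //.
by rewrite -[4%N]/(2 ^ 2)%N leq_exp2l.
Qed.
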